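(* Let $\mathbf{u}=(u_n)_{n\in\mathbb{N}}$ be the Prouhet--Thue--Morse sequence, i.e. $u_n=T_n:=s_2(n)\bmod 2$, where $s_2(n)$ is the sum of binary digits of $n$. Let $a,b$ be independent indeterminates over $\mathbb{Q}$, let $f(0)=f(1)=1$, $f(2)=a+b$ and $$f(n)=a f(n-u_n-1)+b f(n-u_n-2)\qquad (n\ge 3),$$ and put $h(n)=f(n+1)/f(n)\in\mathbb{Q}(a,b)$ for $n\in\mathbb{N}$. Define \begin{align*} d_{-1}&=d_0=1,\\ d_1&=a+b,\\ d_2&=a^2+(a+1)b,\\ d_3&=a^3+b(a^2+2a+b),\\ d_4&=a^4+b(a^3+3a^2+2ab+b),\\ d_5&=a^5+b(a^4+4a^3+3a^2b+3ab+b^2),\\ d_6&=a^6+b(a^5+5a^4+4a^3b+6a^2b+3ab^2+b^2), \end{align*} and $h_i=d_i/d_{i-1}$ for $i\in\{0,1,\ldots,6\}$. Then the sequence $(h(n))_{n\in\mathbb{N}}$ is $2$-automatic and takes values in the set $$\mathcal{V}(f)=\{h(n):n\in\mathbb{N}\}=\{h_0,h_1,h_2,h_3,h_4,h_5,h_6\}.$$ Moreover, for each $i\in\{0,1,\ldots,6\}$ there are infinitely many $n\in\mathbb{N}$ such that $f(n+1)=h_i f(n)$.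
   Context: $\mathbb{N}=\{0,1,2,\ldots\}$. For an integer $k\ge 2$, a sequence $(x_n)_{n\in\mathbb{N}}$ with values in some set is called $k$-automatic if it is generated by a deterministic finite automaton with output reading the base-$k$ representation of $n$; equivalently, if its $k$-kernel $\{(x_{k^jn+i})_{n\in\mathbb{N}}: j\in\mathbb{N},\ 0\le i<k^j\}$ is a finite set and the sequence takes finitely many values. *)

(* Defs.v *)
From HB Require Import structures.
From mathcomp Require Import all_boot all_order all_algebra.
From mathcomp Require Import fraction mpoly.

Set Implicit Arguments.
Unset Strict Implicit.
Unset Printing Implicit Defensive.

Import GRing.Theory.

Record dfao (k : nat) (T : Type) := Dfao {
  dfao_state : finType;
  dfao_init : dfao_state;
  dfao_trans : dfao_state -> 'I_k -> dfao_state;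
  dfao_output : dfao_state -> T
}.

Definition dfao_run (k : nat) (T : Type) (A : dfao k T) (w : seq 'I_k) : T :=
  dfao_output (foldl (@dfao_trans k T A) (dfao_init A) w).

(* Most significant digit first, without leading zeros; 0 is the empty word. *)
Definition is_base_repr (k n : nat) (w : seq 'I_k) : bool :=
  (foldl (fun (m : nat) (i : 'I_k) => m * k + i) 0 w == n)
  && (if w is i :: _ then (i : nat) != 0 else true).

Definition automatic (k : nat) (T : Type) (x : nat -> T) : Prop :=
  1 < k /\
  exists A : dfao k T,
    forall (n : nat) (w : seq 'I_k), is_base_repr n w -> x n = dfao_run A w.

(* The digit of index i is (n %/ 2 ^ i) %% 2; it vanishes for i >= n since
   n < 2 ^ n. *)
Definition binary_digit_sum (n : nat) : nat := \sum_(i < n) (n %/ 2 ^ i) %% 2.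

Definition thue_morse (n : nat) : nat := binary_digit_sum n %% 2.

Local Open Scope ring_scope.

Definition Qab : fieldType := {fraction {mpoly rat[2]}}.
Definition a : Qab := tofrac ('X_0 : {mpoly rat[2]}).
Definition b : Qab := tofrac ('X_1 : {mpoly rat[2]}).

(* Only the indices from -1 to 6 are meaningful; Negz 0 is -1. *)
Definition d (i : int) : Qab :=
  match i with
  | Negz 0 => 1
  | Posz 0 => 1
  | Posz 1 => a + b
  | Posz 2 => a ^+ 2 + (a + 1) * b
  | Posz 3 => a ^+ 3 + b * (a ^+ 2 + 2 * a + b)
  | Posz 4 => a ^+ 4 + b * (a ^+ 3 + 3 * a ^+ 2 + 2 * a * b + b)
  | Posz 5 => a ^+ 5 + b * (a ^+ 4 + 4 * a ^+ 3 + 3 * a ^+ 2 * b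
                            + 3 * a * b + b ^+ 2)
  | Posz 6 => a ^+ 6 + b * (a ^+ 5 + 5 * a ^+ 4 + 4 * a ^+ 3 * b
                            + 6 * a ^+ 2 * b + 3 * a * b ^+ 2 + b ^+ 2)
  | _ => 0
  end.

Definition hval (i : 'I_7) : Qab := d (i : nat)%:Z / d ((i : nat)%:Z - 1).

(* Main.v *)
Require Import Defs.
From mathcomp Require Import all_boot all_order all_algebra.
From mathcomp Require Import fraction mpoly.
From mathcomp Require Import ring zify.
Import GRing.Theory.
Local Open Scope ring_scope.

(** The polynomials d_i of the statement satisfy d_i = a d_(i-1) + b d_(i-2),
    so h_i = a + b / h_(i-1) with h_0 = 1.  Writing h(n) = h_(g(n)), the whole
    question is about the sequence of levels g(n), which is governed by the
    letters of the Thue-Morse word alone.  For n >= 3: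

    - if u_n = 0, then f(n) = a f(n-1) + b f(n-2), so
      h(n-1) = a + b / h(n-2) and g(n-1) = g(n-2) + 1;
    - if u_(n-1) u_n = 01, then n >= 4 as u_3 = 0, and f(n) and f(n-1) are given
      by the same formula a f(n-2) + b f(n-3), so h(n-1) = 1 and g(n-1) = 0;
    - if u_(n-1) u_n = 11, then u_(n-2) = 0 because the word has no cube 111,
      so f(n-1) = f(n-2) by the previous case; now
      f(n) = a f(n-2) + b f(n-3) reads h(n-1) = a + b / h(n-3), that is
      g(n-1) = g(n-3) + 1.

    Every occurrence of 01 resets the level to 0, and the level counts steps
    since a bounded time before, so it is a function of a bounded window of the
    Thue-Morse word; hence it is 2-automatic, and bounded.

    Instead of estimating windows, an explicit automaton with 17 states is used:
    its states, read along n = 0, 1, 2, ..., form the fixed point of a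
    2-uniform morphism, and each state determines both a level and a letter.
    That the letters are the Thue-Morse word follows by induction along
    n -> 2n + c ([letter_state]).  That the levels obey the three rules above is
    a property of four consecutive states, and the set of blocks of four
    consecutive states is finite, closed under the morphism and contains the
    initial block, so a finite computation settles it ([level_rule]).  The
    recurrence then gives h(n) = h_(g(n)) ([ratio_level]).  Finally, from every
    state each of the 7 levels can be reached by appending five binary digits,
    so each level occurs beyond every bound ([level_infinitely_often]). *)

(** * The continuants d_i and their ratios *)

(** Shifted by one: [cont a b n] is d_(n-1), so that the two initial values 1
    are d_(-1) and d_0. *)
Definition cont (R : pzRingType) (x y : R) (n : nat) : R :=
  (iter n (fun p => (p.2, x * p.2 + y * p.1)) (1, 1)).1.

Lemma contSS (R : pzRingType) (x y : R) (n : nat) :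
  cont R x y n.+2 = x * cont R x y n.+1 + y * cont R x y n.
Proof. by []. Qed.

Lemma rmorph_cont (R S : pzRingType) (phi : {rmorphism R -> S}) (x y : R) n :
  phi (cont R x y n) = cont S (phi x) (phi y) n.
Proof.
suff: phi (cont R x y n) = cont S (phi x) (phi y) n
   /\ phi (cont R x y n.+1) = cont S (phi x) (phi y) n.+1 by case.
elim: n => [|n [IH1 IH2]]; first by rewrite /cont /= rmorph1.
by split=> //; rewrite !contSS rmorphD !rmorphM IH1 IH2.
Qed.

Lemma cont11_gt0 (n : nat) : 0 < cont rat 1 1 n.
Proof.
suff: (0 < cont rat 1 1 n) && (0 < cont rat 1 1 n.+1) by case/andP.
elim: n => [//|n /andP[IH1 IH2]].
by rewrite IH2 contSS !mul1r Num.Theory.addr_gt0.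
Qed.

(** At a = b = 1 the continuant is a Fibonacci number, hence positive, so the
    polynomial in two indeterminates is not zero. *)
Lemma cont_ab_neq0 (n : nat) : cont Qab a b n != 0.
Proof.
have <- : tofrac (cont {mpoly rat[2]} 'X_0 'X_1 n) = cont Qab a b n.
  by rewrite rmorph_cont.
rewrite tofrac_eq0; apply/eqP => /(congr1 (meval (fun=> 1))).
rewrite meval0 rmorph_cont /= !mevalXU => cont0.
by have := cont11_gt0 n; rewrite cont0 Order.POrderTheory.ltxx.
Qed.

Definition ratio (k : nat) : Qab := cont Qab a b k.+1 / cont Qab a b k.

Lemma ratio0 : ratio 0 = 1.
Proof. by rewrite /ratio divr1. Qed.

Lemma ratioS (k : nat) : ratio k.+1 = a + b / ratio k.
Proof.
rewrite /ratio contSS mulrDl mulfK ?cont_ab_neq0 //.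
by rewrite invf_div mulrA.
Qed.

Lemma ratio_neq0 (k : nat) : ratio k != 0.
Proof. by rewrite mulf_neq0 ?invr_neq0 ?cont_ab_neq0. Qed.

Lemma hvalE (i : 'I_7) : hval i = ratio i.
Proof.
rewrite /hval /ratio; case: i => -[|[|[|[|[|[|[|//]]]]]]] /= _;
  rewrite /cont /=; congr (_ / _); ring.
Qed.

(** One step of the recurrence, common to the letters 0 and 11: from two values
    of f with ratio h_k it produces a third one with ratio h_(k+1). *)
Lemma ratio_step (x0 x1 : Qab) (k : nat) :
  x1 = ratio k * x0 -> a * x1 + b * x0 = ratio k.+1 * x1.
Proof.
by move=> ->; rewrite ratioS mulrDl [X in _ = _ + X]mulrA divfK ?ratio_neq0.
Qed.

(** * Thue-Morse letters of 2n and 2n + 1 *)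
Local Open Scope nat_scope.

(** The digits of index at least n vanish because n < 2 ^ n; a common number of
    digits can thus be used for n and for 2n + c. *)
Lemma sum_digits (n k : nat) :
  n <= k -> \sum_(i < k) (n %/ 2 ^ i) %% 2 = binary_digit_sum n.
Proof.
move=> /subnK <-; elim: (k - n) => [//|j IH].
rewrite addSn big_ord_recr /= IH divn_small ?addn0 //.
exact: leq_ltn_trans (leq_addl _ _) (ltn_expl _ (ltnSn 1)).
Qed.

Lemma thue_morse_double (n : nat) (c : bool) :
  thue_morse (c + n.*2) = (c + thue_morse n) %% 2.
Proof.
rewrite /thue_morse modnDmr -(sum_digits (c + n.*2) (n + c + n).+1); last lia.
rewrite big_ord_recl expn0 divn1 -(sum_digits n (n + c + n)); last lia.
rewrite -modnDml modn_mod; congr ((_ + _) %% 2); last first.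
  apply: eq_bigr => i _; rewrite /= /bump add1n expnS divnMA.
  by congr (_ %/ _ %% 2); lia.
lia.
Qed.

(** * An automaton for levels and letters *)

(** Two integers n and n' are in the same state when g(2^k n + t) =
    g(2^k n' + t) for all k and all t < 2^k.  The states are numbered by least
    elements: 0, 1, ..., 9, 11, 12, 13, 14, 23, 25, 26. *)
Definition trans (q : nat) (c : bool) : nat :=
  let (q0, q1) := nth (0, 0)
    [:: (0, 1); (2, 3); (4, 5); (6, 7); (8, 9); (6, 10); (11, 12); (13, 3);
        (4, 5); (6, 10); (13, 14); (6, 15); (16, 3); (4, 5); (6, 10);
        (13, 3); (4, 5)] q in
  if c then q1 else q0.

Definition level_of (q : nat) : nat :=
  nth 0 [:: 0; 1; 2; 0; 1; 2; 0; 3; 4; 5; 1; 0; 2; 3; 4; 5; 6] q.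

Definition letter_of (q : nat) : nat :=
  nth 0 [:: 0; 1; 1; 0; 1; 0; 0; 1; 1; 0; 1; 0; 1; 1; 0; 1; 1] q.

(** The state reached after reading n, most significant digit first; the fuel
    [k] bounds the number of digits.  Surplus fuel reads leading zeros, which
    fix state 0. *)
Fixpoint state_upto (k n : nat) : nat :=
  if k is k'.+1 then trans (state_upto k' n./2) (odd n) else 0.

Definition state (n : nat) : nat := state_upto n n.

Lemma state_upto_stable (k l n : nat) :
  n <= k -> n <= l -> state_upto k n = state_upto l n.
Proof.
have upto0 m : state_upto m 0 = 0 by elim: m => //= m ->.
elim: k l n => [|k IH] [|l] [|n] //= le_nk le_nl; try by rewrite !upto0.
by rewrite (IH l) //; lia.
Qed.

(** The sequence of states is the fixed point of the morphism that sends q to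
    [trans q false], [trans q true]. *)
Lemma state_double (n : nat) (c : bool) : state (c + n.*2) = trans (state n) c.
Proof.
rewrite /state (state_upto_stable _ (c + n.*2).+1) // [LHS]/= half_bit_double.
by rewrite oddD odd_double addbF oddb (state_upto_stable _ n) //; lia.
Qed.

Lemma double_ind (P : nat -> Prop) :
  P 0 -> (forall n (c : bool), P n -> P (c + n.*2)) -> forall n, P n.
Proof.
move=> P0 Pdouble; elim/ltn_ind=> -[//|n] IH.
by rewrite -(odd_double_half n.+1); apply/Pdouble/IH; lia.
Qed.

Lemma trans_lt17 (q : nat) (c : bool) : trans q c < 17.
Proof.
case: (ltnP q 17) => [|le17q]; last by rewrite /trans nth_default //; case: c.
by case: c; do 17!case: q => [//|q].
Qed.

Lemma state_lt17 (n : nat) : state n < 17.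
Proof. by case: n => [//|n]; apply: trans_lt17. Qed.

Lemma letter_trans (q : nat) (c : bool) :
  q < 17 -> letter_of (trans q c) = (c + letter_of q) %% 2.
Proof. by case: c; do 17!case: q => [//|q]. Qed.

Lemma letter_state (n : nat) : letter_of (state n) = thue_morse n.
Proof.
elim/double_ind: n => [|n c IH].
  by rewrite /thue_morse /binary_digit_sum big_ord0.
by rewrite state_double letter_trans ?state_lt17 // thue_morse_double IH.
Qed.

(** * The rules satisfied by the levels *)
Definition level (n : nat) : nat := level_of (state n).

Definition expand (w : seq nat) : seq nat :=
  flatten [seq [:: trans q false; trans q true] | q <- w].

Definition window (n : nat) : seq nat := [seq state (n + i) | i <- iota 0 4].

(** The sequence of states has 24 distinct blocks of length four, and the last
    of them appears at position 26. *)
Definition windows : seq (seq nat) := [seq window n | n <- iota 0 27].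

(** Four consecutive entries from 2n or 2n + 1 on lie in the image of the block
    at n, so a block determines its two descendants. *)
Lemma window_double (n : nat) (c : bool) :
  window (c + n.*2) = take 4 (drop c (expand (window n))).
Proof.
rewrite /window /expand; case: c; rewrite /= -!state_double;
  do 4!(congr (_ :: _); first by congr state; lia).
all: by [].
Qed.

Lemma windows_closed (w : seq nat) (c : bool) :
  w \in windows -> take 4 (drop c (expand w)) \in windows.
Proof.
have closed : all (fun w => (take 4 (drop false (expand w)) \in windows)
    && (take 4 (drop true (expand w)) \in windows)) windows by vm_compute.
by move=> /(allP closed)/andP[]; case: c.
Qed.

Lemma window_in_windows (n : nat) : window n \in windows.
Proof.
elim/double_ind: n => [|n c IH]; first by vm_compute.
by rewrite window_double windows_closed.
Qed.

(** The block stands for the states at n-3, n-2, n-1, n in the notation of the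
    introduction. *)
Definition obeys_rule (w : seq nat) : bool :=
  let q i := nth 0 w i in
  if letter_of (q 3) == 0 then level_of (q 2) == (level_of (q 1)).+1
  else if letter_of (q 2) == 0 then level_of (q 2) == 0
  else (level_of (q 1) == 0) && (level_of (q 2) == (level_of (q 0)).+1).

(** In the last case the first equation, g(n-2) = 0, is where the absence of the
    cube 111 enters. *)
Lemma level_rule (n : nat) :
  if thue_morse n.+3 == 0 then level n.+2 = (level n.+1).+1
  else if thue_morse n.+2 == 0 then level n.+2 = 0
  else level n.+1 = 0 /\ level n.+2 = (level n).+1.
Proof.
have rules : all obeys_rule windows by vm_compute.
have /(allP rules) := window_in_windows n.
rewrite /obeys_rule /= addn0 addn1 addn2 addn3 !letter_state.
by do 2?[case: ifP => _ /=]; [move/eqP | move/eqP | case/andP=> /eqP ? /eqP ?].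
Qed.

Lemma level_lt7 (n : nat) : level n < 7.
Proof.
by rewrite /level; move: (state n) (state_lt17 n); do 17!case=> [//|].
Qed.

(** * Automaticity and recurrence of the levels *)
Definition digit (i : 'I_2) : bool := i == 1 :> nat.

Definition level_dfao : dfao 2 Qab :=
  @Dfao 2 Qab 'I_17 ord0 (fun q i => Ordinal (trans_lt17 q (digit i)))
    (fun q => ratio (level_of q)).

(** Holds for every word of digits, not only for canonical representations,
    since [state_double] is valid at n = 0 as well. *)
Lemma foldl_trans (w : seq 'I_2) (q : 'I_17) (n : nat) : q = state n :> nat ->
  foldl (@dfao_trans 2 Qab level_dfao) q w
    = state (foldl (fun (m : nat) (i : 'I_2) => m * 2 + i) n w) :> nat.
Proof.
elim: w q n => [//|i w IH] q n q_n /=; apply: IH => /=.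
rewrite q_n -state_double; congr state.
by case: i => -[|[|//]] lt_i2; rewrite /digit /=; lia.
Qed.

Lemma automatic_ratio (h : nat -> Qab) :
  (forall n, h n = ratio (level n)) -> automatic 2 h.
Proof.
move=> h_ratio; split=> //; exists level_dfao => n w /andP[/eqP w_n _].
by rewrite h_ratio /dfao_run /= (@foldl_trans w ord0 0) // w_n.
Qed.

(** The [k]-fold image of a state at n consists of the states at the integers
    2^k n + t with t < 2^k, which are all at least n. *)
Lemma expand_state (k n q : nat) : q \in iter k expand [:: state n] ->
  exists2 m, n <= m & state m = q.
Proof.
elim: k q => [|k IH] q; first by rewrite inE => /eqP ->; exists n.
case/flatten_mapP=> p /IH[m le_nm <-]; rewrite !inE => /orP[]/eqP ->.
- by exists (false + m.*2); [lia | rewrite state_double].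
- by exists (true + m.*2); [lia | rewrite state_double].
Qed.

Lemma level_infinitely_often (i N : nat) :
  i < 7 -> exists2 n, N <= n & level n = i.
Proof.
move=> lt_i7.
(* Five is the least length for which the following holds. *)
pose reaches q j := j \in map level_of (iter 5 expand [:: q]).
have reach : all (fun q => all (reaches q) (iota 0 7)) (iota 0 17).
  by vm_compute.
have /allP/(_ i) : all (reaches (state N)) (iota 0 7).
  by apply: (allP reach); rewrite mem_iota state_lt17.
by rewrite mem_iota => /(_ lt_i7)/mapP[q /expand_state[n le_Nn <-] ->]; exists n.
Qed.

Local Open Scope ring_scope.

(** * From levels to the sequence f *)

(** Stated as a product, so that the nonvanishing of f follows from it. *)
Lemma ratio_level (f : nat -> Qab)
  (f0 : f 0%N = 1) (f1 : f 1%N = 1) (f2 : f 2%N = a + b)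
  (frec : forall n : nat, f n.+3 = a * f (n.+3 - thue_morse n.+3 - 1)%N
                                 + b * f (n.+3 - thue_morse n.+3 - 2)%N) (n : nat) :
  f n.+1 = ratio (level n) * f n.
Proof.
elim/ltn_ind: n => -[|[|n]] IH.
- by rewrite f0 f1 ratio0 mulr1.
- by rewrite f1 f2 ratioS ratio0 divr1 mulr1.
have := level_rule n; have := frec n.
have : (thue_morse n.+3 < 2)%N by rewrite ltn_mod.
case: (thue_morse n.+3) => [|[|//]] _ /=.
  rewrite subn0 !subSS !subn0 => -> ->.
  exact/ratio_step/IH.
rewrite !subSS !subn0 => fn.
case: eqP => [tm0 ->|/eqP tm1 [lvl1 ->]].
  rewrite ratio0 mul1r.
  (* Letters 01: the recurrence is also needed at the previous index, which is
     at least 3 since the letter of index 2 is not 0. *)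
  case: n fn tm0 IH => [|n] fn tm0 IH.
    by move: tm0; rewrite -letter_state.
  by rewrite fn frec tm0 subn0 !subSS !subn0.
(* Letters 11: level 0 one step earlier says that f takes the same value at the
   two previous indices. *)
rewrite (IH n.+1) // lvl1 ratio0 mul1r fn.
exact/ratio_step/IH.
Qed.

Theorem theorem3p1 (u : nat -> nat) (f h : nat -> Qab)
  (hu : forall n : nat, u n = thue_morse n)
  (f0 : f 0%N = 1) (f1 : f 1%N = 1) (f2 : f 2%N = a + b)
  (frec : forall n : nat, (3 <= n)%N ->
     f n = a * f (n - u n - 1)%N + b * f (n - u n - 2)%N)
  (hh : forall n : nat, h n = f n.+1 / f n) :
  [/\ automatic 2 h,
      forall v : Qab, (exists n : nat, h n = v) <-> (exists i : 'I_7, v = hval i)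
    & forall (i : 'I_7) (N : nat),
        exists n : nat, (N <= n)%N /\ f n.+1 = hval i * f n].
Proof.
have f_ratio n : f n.+1 = ratio (level n) * f n.
  by apply: ratio_level => // m; rewrite frec // hu.
have f_neq0 n : f n != 0.
  elim: n => [|n IH]; first by rewrite f0 oner_neq0.
  by rewrite f_ratio mulf_neq0 ?ratio_neq0.
have h_ratio n : h n = ratio (level n) by rewrite hh f_ratio mulfK.
split=> [|v|i N].
- exact: automatic_ratio.
- split=> [[n <-]|[i ->]].
    by exists (Ordinal (level_lt7 n)); rewrite hvalE.
  have [n _ lvl_n] := level_infinitely_often i 0 (ltn_ord i).
  by exists n; rewrite h_ratio lvl_n hvalE.
- have [n le_Nn lvl_n] := level_infinitely_often i N (ltn_ord i).
  by exists n; rewrite hvalE f_ratio lvl_n.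
Qed.
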